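(* Let $p$ be a prime, let $\nu$ be a positive integer and let $k\ge 0$ be an integer. Let $A$ be a finite abelian group of order $m$ such that $p\nmid m$. Then $$\mathrm{avg}_{p^\nu}^{\rm E}(A\times\mathbb{Z}_{p^k})= mp^k\left(\frac{1}{3}-\frac{1}{6(p^k+1)}\right)-|Q_{p^\nu}(A)|\left(\frac{p^k+1}{12}+\frac{2-3\delta_p}{12(p^k+1)}\right),$$ where $\delta_p=1$ if $p=2$ and $\delta_p=0$ if $p$ is odd.
   Context: For a finite abelian group $G$ (written additively), $\mathbb{F}_{p^\nu}[G]$ is the group algebra of $G$ over the finite field $\mathbb{F}_{p^\nu}$ with $p^\nu$ elements, with elements written $\sum_{g\in G}u_gY^g$. An abelian code in $\mathbb{F}_{p^\nu}[G]$ is an ideal of $\mathbb{F}_{p^\nu}[G]$, and $\mathcal{C}(p^\nu,G)$ is the set of all of them. The Euclidean inner product is $\langle u,v\rangle_{\rm E}=\sum_{g\in G}u_gv_g$; the Euclidean dual of a code $C$ is $C^{\perp_{\rm E}}=\{v\in\mathbb{F}_{p^\nu}[G] : \langle c,v\rangle_{\rm E}=0 \text{ for all } c\in C\}$, and the Euclidean hull is $\mathcal{H}_{\rm E}(C)=C\cap C^{\perp_{\rm E}}$. The average dimension of the Euclidean hull is $$\mathrm{avg}_{p^\nu}^{\rm E}(G)=\frac{\sum_{C\in\mathcal{C}(p^\nu,G)}\dim(\mathcal{H}_{\rm E}(C))}{|\mathcal{C}(p^\nu,G)|},$$ where $\dim$ is the dimension over $\mathbb{F}_{p^\nu}$. For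 a positive integer $q$ coprime to $|A|$, the $q$-cyclotomic class of $a\in A$ is $S_q(a)=\{q^i\cdot a : i=0,1,2,\dots\}$, and $Q_{p^\nu}(A)=\{a\in A : -a\in S_{p^\nu}(a)\}$. $\mathbb{Z}_{p^k}$ is the cyclic group of order $p^k$.
   Formalization: The case p = 2, k = 0 is excluded: there the printed formula always exceeds the true average by |Q|/8 > 0 (for example p = 2, ν = 1, k = 0, A trivial gives average 0 but right-hand side 1/8). *)

(* Defs.v *)
From HB Require Import structures.
From mathcomp Require Import all_boot all_order all_algebra all_field.

Set Implicit Arguments.
Unset Strict Implicit.
Unset Printing Implicit Defensive.

Import GRing.Theory.
Local Open Scope ring_scope.

HB.instance Definition _ (A B : finZmodType) := Finite.on (A * B)%type.

(* Residues modulo n, for n > 0 only.  Unlike 'Z_n, this is the trivial       *)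
(* group when n = 1.                                                          *)
Definition Zcyc (n : nat) : finZmodType := 'I_n.-1.+1.

Lemma card_Zcyc n : (0 < n)%N -> #|Zcyc n| = n.
Proof. by move=> n_gt0; rewrite card_ord prednK. Qed.

Section GroupAlgebra.
Variables (F : finFieldType) (G : finZmodType).

(* The element \sum_g u_g Y^g is the function u.  {ffun G -> F} already       *)
(* carries the pointwise product, hence the alias.                            *)
Definition galg : Type := {ffun G -> F}.

HB.instance Definition _ := Finite.copy galg {ffun G -> F}.
HB.instance Definition _ := Vector.copy galg {ffun G -> F^o}.

Implicit Types u v w : galg.
Definition coef u (g : G) : F := (u : {ffun G -> F}) g.
Definition galg_of (f : G -> F) : galg := [ffun g => f g].

Lemma galg_ofE f g : coef (galg_of f) g = f g. Proof. exact: ffunE. Qed.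

Lemma galgP u v : coef u =1 coef v <-> u = v.
Proof. by split=> [/ffunP | ->]. Qed.

Lemma coefD u v g : coef (u + v) g = coef u g + coef v g.
Proof. exact: ffunE. Qed.

Lemma coefZ a u g : coef (a *: u) g = a * coef u g.
Proof. exact: ffunE. Qed.

Definition galg_one : galg := galg_of (fun g => (g == 0)%:R).
Definition galg_mul u v : galg :=
  galg_of (fun g => \sum_h coef u h * coef v (g - h)).

Fact galg_mulC : commutative galg_mul.
Proof.
move=> u v; apply/galgP => g; rewrite !galg_ofE.
rewrite (reindex_inj (inj_comp (addrI g) oppr_inj)) /=.
by apply: eq_bigr => h _; rewrite mulrC opprD opprK addNKr.
Qed.

Fact galg_mulA : associative galg_mul.
Proof.
move=> u v w; apply/galgP => g; rewrite !galg_ofE.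
under eq_bigr => h _ do rewrite galg_ofE mulr_sumr.
under [RHS]eq_bigr => h _ do rewrite galg_ofE mulr_suml.
rewrite [RHS]exchange_big; apply: eq_bigr => h _ /=.
rewrite [RHS](reindex_inj (addrI h)) /=; apply: eq_bigr => k _.
by rewrite mulrA [h + k]addrC addrK opprD addrA addrAC.
Qed.

Fact galg_mul1 : left_id galg_one galg_mul.
Proof.
move=> u; apply/galgP => g; rewrite !galg_ofE (bigD1 0) //= galg_ofE eqxx.
by rewrite mul1r subr0 big1 ?addr0 // => h /negPf h0; rewrite galg_ofE h0 mul0r.
Qed.

Fact galg_mulDl : left_distributive galg_mul +%R.
Proof.
move=> u v w; apply/galgP => g; rewrite coefD !galg_ofE -big_split /=.
by apply: eq_bigr => h _; rewrite coefD mulrDl.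
Qed.

Fact galg_one_neq0 : galg_one != 0.
Proof.
apply/eqP => /galgP/(_ 0); rewrite galg_ofE eqxx [RHS]ffunE.
by apply/eqP; rewrite oner_neq0.
Qed.

HB.instance Definition _ := GRing.Zmodule_isComNzRing.Build galg
  galg_mulA galg_mulC galg_mul1 galg_mulDl galg_one_neq0.

Fact galg_scaleAl (a : F) u v : a *: (u * v) = (a *: u) * v.
Proof.
apply/galgP => g; rewrite coefZ !galg_ofE mulr_sumr.
by apply: eq_bigr => h _; rewrite coefZ mulrA.
Qed.

HB.instance Definition _ := GRing.Lmodule_isLalgebra.Build F galg galg_scaleAl.

End GroupAlgebra.

Definition is_ideal (R : finComNzRingType) (I : {set R}) : bool :=
  [&& 0 \in I,
      [forall x in I, forall y in I, x - y \in I]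
    & [forall a, forall x in I, a * x \in I]].

Section Codes.
Variables (F : finFieldType) (G : finZmodType).

Definition abelian_codes : {set {set galg F G}} := [set C | is_ideal C].

Definition euclid (u v : galg F G) : F := \sum_g coef u g * coef v g.

Definition euclid_dual (C : {set galg F G}) : {set galg F G} :=
  [set v | [forall c in C, euclid c v == 0]].

Definition euclid_hull (C : {set galg F G}) : {set galg F G} :=
  C :&: euclid_dual C.

Definition dimF (C : {set galg F G}) : nat := \dim <<enum C>>%VS.

(* Hulls are subspaces, hence equal to the span taken in dimF.                *)
Lemma span_subspace (C : {set galg F G}) :
  submod_closed C -> <<enum C>>%VS =i C.
Proof.
case=> C0 CP v; apply/idP/idP => [|vC]; last by rewrite memv_span ?mem_enum.
rewrite -{1}[enum C]/(val (in_tuple (enum C))) => /coord_span ->.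
elim/big_rec: _ => [//|i x _ xC]; apply: CP => //.
by rewrite -mem_enum mem_nth.
Qed.

Lemma euclid_hull_submod (C : {set galg F G}) :
  C \in abelian_codes -> submod_closed (euclid_hull C).
Proof.
rewrite inE => /and3P[C0 /forall_inP CB /forallP CM].
have CZ (a : F) x : x \in C -> a *: x \in C.
  by move=> xC; rewrite -[x]mul1r scalerAl; apply: (forall_inP (CM _)).
have CD x y : x \in C -> y \in C -> x + y \in C.
  move=> xC yC; have := forall_inP (CB _ xC) _ (CZ (-1) _ yC).
  by rewrite scaleN1r opprK.
split=> [|a x y]; rewrite !inE.
  rewrite C0; apply/forall_inP => c _.
  by rewrite /euclid big1 // => g _; rewrite [coef 0 g]ffunE mulr0.
move=> /andP[xC /forall_inP xD] /andP[yC /forall_inP yD].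
rewrite CD ?CZ //=; apply/forall_inP => c cC.
suff -> : euclid c (a *: x + y) = a * euclid c x + euclid c y.
  by rewrite (eqP (xD c cC)) (eqP (yD c cC)) mulr0 addr0.
rewrite /euclid mulr_sumr -big_split; apply: eq_bigr => g _.
by rewrite coefD coefZ mulrDr mulrCA.
Qed.

Definition avg_hull_dim : rat :=
  (\sum_(C in abelian_codes) dimF (euclid_hull C))%:R / #|abelian_codes|%:R.

End Codes.

Section Cyclotomic.
Variable A : finZmodType.

Definition cyclotomic_class (q : nat) (a : A) : {set A} :=
  [set b | fconnect (fun x => x *+ q) a b].

Lemma cyclotomic_classP q a b :
  reflect (exists i, b = a *+ (q ^ i)) (b \in cyclotomic_class q a).
Proof.
have iterE i : iter i (fun x : A => x *+ q) a = a *+ (q ^ i).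
  by elim: i => [|i IHi] //=; rewrite IHi -mulrnA expnSr.
rewrite inE; apply: (iffP idP) => [/iter_findex <- | [i ->]].
  by exists (findex (fun x => x *+ q) a b); rewrite iterE.
by rewrite -iterE fconnect_iter.
Qed.

Definition Qset (q : nat) : {set A} := [set a | - a \in cyclotomic_class q a].

End Cyclotomic.

(* Main.v *)
(* Write q = |F|, n = p^k, X = Y^(0,1) and pi = X - 1, so that pi^n = 0.  Over
   a finite extension L of F containing the |A|-th roots of unity, a
   nondegenerate symmetric pairing A x A -> L^* indexes the characters
   chi_a : F[A x Z_n] -> L by A itself.  Then chi_(qa) = chi_a^q, the common
   kernel of the chi_a is generated by pi, and each orbit of multiplication by q
   on A carries an idempotent e whose component is a chain ring with ideals
   generated by e pi^j.  Ideals thus correspond to functions s : A -> [0, n]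
   invariant under multiplication by q, with codimension \sum_a s(a).  Duality
   is s |-> (a |-> n - s(-a)), hence the hull has dimension
   \sum_a (n - max(s(a), n - s(-a))).  For a uniform invariant s, the pair
   (s(a), s(-a)) is uniform on the diagonal if -a is in the orbit of a, and
   uniform on all pairs otherwise. *)

From HB Require Import structures.
Require Import Defs.
From mathcomp Require Import all_boot all_order all_algebra all_field.
From mathcomp Require Import all_fingroup all_solvable.
From mathcomp Require Import ring zify.
Import GRing.Theory.
Local Open Scope ring_scope.

Set Implicit Arguments.
Unset Strict Implicit.
Unset Printing Implicit Defensive.

(** * Roots of unity and a self-duality of finite abelian groups *)

(** [X^m - 1] is separable since m is nonzero in [F], so it has m distinct roots in its splitting
    field, and m distinct m-th roots of unity include a primitive one. *)
Lemma finField_prim_root_ext (F : finFieldType) m : m%:R != 0 :> F ->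
  exists (L : finFieldType) (iota : {rmorphism F -> L}) (z : L),
    m.-primitive_root z.
Proof.
move=> m_neq0.
have m_gt0 : (0 < m)%N by case: m m_neq0 => //; rewrite eqxx.
have /FinSplittingFieldFor[L [zs Dzs _]] : (('X^m - 1)%R : {poly F}) != 0.
  by rewrite monic_neq0 ?monicXnsubC.
exists (FinFieldExtType L), (in_alg L).
move: Dzs; rewrite rmorphB rmorphXn /= map_polyX rmorph1 => Dzs.
have sz : size zs = m.
  apply: succn_inj; rewrite -(size_prod_XsubC zs id) -(eqp_size Dzs).
  by rewrite size_XnsubC.
have Uzs : uniq zs.
  rewrite -separable_prod_XsubC -(eqp_separable Dzs).
  by rewrite separable_Xn_sub_1 // -(rmorph_nat (in_alg L)) fmorph_eq0.
have /hasP[z _ zP] : has m.-primitive_root (zs : seq L); last by exists z.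
apply: has_prim_root => //; last by rewrite sz.
apply/allP=> z zP; rewrite unity_rootE -subr_eq0.
have: root ('X^m - 1) z by rewrite (eqp_root Dzs) root_prod_XsubC.
by rewrite rootE !hornerE.
Qed.

Section Pairing.
Local Open Scope group_scope.

(** Induction on the cyclic factors: a new factor [<[x]>] is paired with itself by sending [x ^+ i],
    [x ^+ j] to [y ^+ (i * j)], where y has the order of x, and the result is multiplied by the
    pairing of the complement [H]. *)
Lemma dprod_cycles_pairing (gT : finGroupType) (L : fieldType) (N : nat)
    (z : L) (b : seq gT) (G : {group gT}) :
  N.-primitive_root z -> (forall x, x \in b -> #[x] %| N)%N ->
  \big[dprod/1]_(x <- b) <[x]> = G ->
  exists B : gT -> gT -> L,
    [/\ forall g h, B g h = B h g, {in G, forall h, B 1 h = 1%R},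
        {in G & &, forall g g' h, B (g * g') h = (B g h * B g' h)%R}
      & {in G, forall g : gT, g != 1 -> exists2 h, h \in G & B g h != 1%R}].
Proof.
move=> z_prim; elim: b G => [|x b IHb] G dvd_b.
  rewrite big_nil => defG; exists (fun _ _ => 1%R); split=> //.
    by move=> *; rewrite GRing.mulr1.
  by move=> g; rewrite -defG => /set1gP -> /eqP[].
rewrite big_cons => defG.
have [[_ H _ defH] _ _ _] := dprodP defG.
have [|B [BC B1 BM Bnd]] := IHb H _ defH.
  by move=> y yb; apply: dvd_b; rewrite inE yb orbT.
rewrite defH in defG; have [_ mulG cHx tiHx] := dprodP defG.
have cplH : H \in [complements to <[x]> in G] by apply/complP.
have nxG : <[x]> <| G by case/dprod_normal2: defG.
pose r := remgr <[x]> H; pose d := divgr <[x]> H.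
have dP g : g \in G -> d g \in <[x]> by rewrite -mulG => /mem_divgr.
have rP g : g \in G -> r g \in H by rewrite -mulG => /mem_remgr.
have rM : {in G &, {morph r : g h / g * h}} by apply: remgrM.
have dM : {in G &, {morph d : g h / g * h}} by apply: divgrM.
(* [l g] is a discrete logarithm to base x, with default 0 outside [<[x]>]. *)
pose l g : nat := if [pick i : 'I_#[x] | x ^+ i == g] is Some i then i else 0.
have lP g : g \in <[x]> -> x ^+ l g = g.
  rewrite /l; case: pickP => [i /eqP //|xg] /cyclePmin[i ltix Dg].
  by have := xg (Ordinal ltix); rewrite Dg eqxx.
have x_gt0 := order_gt0 x.
have := dvdn_prim_root z_prim (dvd_b x (mem_head x b)).
set y := (z ^+ _)%R => y_prim.
have lE g i : x ^+ i = g -> (y ^+ l g = y ^+ i)%R.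
  move=> <-; apply/eqP; rewrite (eq_prim_root_expr y_prim).
  by rewrite -eq_expg_mod_order lP ?mem_cycle.
have lM g h k : g \in <[x]> -> h \in <[x]> ->
    (y ^+ (l (g * h)%g * k) = y ^+ (l g * k) * y ^+ (l h * k))%R.
  move=> gx hx; rewrite !GRing.exprM (lE _ (l g + l h)%N) ?expgD ?lP //.
  by rewrite GRing.exprD GRing.exprMn.
have r1 : r 1 = 1 by apply: remgr1.
have d1 : d 1 = 1 by apply: divgr_id.
have y1 k : (y ^+ (l 1%g * k) = 1)%R.
  by rewrite GRing.exprM (lE _ 0%N) // GRing.expr0 GRing.expr1n.
exists (fun g h => B (r g) (r h) * y ^+ (l (d g) * l (d h)))%R; split.
- by move=> g h; rewrite BC mulnC.
- by move=> h hG; rewrite r1 d1 B1 ?rP // y1 GRing.mulr1.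
- move=> g g' h gG g'G hG; rewrite rM // dM // BM ?rP // lM ?dP //.
  by rewrite GRing.mulrACA.
(* If the [H]-component of g is nontrivial, the witness comes from the induction; otherwise g is a
   power of x, and x itself detects it. *)
move=> g gG g1; have [rg1|rg1] := eqVneq (r g) 1; last first.
  have [h hH Bh] := Bnd _ (rP _ gG) rg1; exists h.
    by rewrite -mulG; apply: (subsetP (mulG_subr _ _)).
  have rh : r h = h by apply: remgr_id.
  have -> : d h = 1 by rewrite /d /divgr -/(r h) rh mulgV.
  by rewrite rh mulnC y1 GRing.mulr1.
have Dg : g = d g by rewrite {1}(divgr_eq <[x]> H g) -/(r g) rg1 mulg1.
exists x.
  by rewrite -mulG; apply: (subsetP (mulG_subl _ _)); rewrite ?cycle_id.
have -> : r x = 1 by apply: remgr1; rewrite ?cycle_id.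
have -> : d x = x by apply: divgr_id; rewrite ?cycle_id.
rewrite rg1 B1 // GRing.mul1r mulnC GRing.exprM (lE _ 1%N) // GRing.expr1.
rewrite -(prim_order_dvd y_prim) order_dvdn; apply: contra g1.
by rewrite lP ?dP // -Dg.
Qed.
End Pairing.

Lemma zmod_pairing (A : finZmodType) (L : fieldType) (z : L) :
  #|A|.-primitive_root z ->
  exists B : A -> A -> L,
    [/\ forall a b, B a b = B b a,
        forall a a' b, B (a + a') b = B a b * B a' b,
        forall b, B 0 b = 1
      & forall a, a != 0 -> exists b, B a b != 1].
Proof.
move=> z_prim.
have [b defA _] := abelian_structure (FinRing.Theory.zmod_abelian [set: A]).
have [|B [BC B1 BM Bnd]] := dprod_cycles_pairing z_prim _ defA.
  by move=> x _; rewrite -cardsT order_dvdG ?inE.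
exists B; split=> //.
- by move=> a a' c; rewrite -[RHS]BM ?inE.
- by move=> c; rewrite -[RHS](B1 c) ?inE.
by move=> a a0; have [||c _] := Bnd a; rewrite ?inE //; exists c.
Qed.

Lemma sum_exprn_pchar (S : comNzSemiRingType) (I : Type) (r : seq I)
    (P : pred I) (f : I -> S) N : [pchar S].-nat N ->
  (\sum_(i <- r | P i) f i) ^+ N = \sum_(i <- r | P i) f i ^+ N.
Proof.
move=> N_char; have /andP[N_gt0 _] := N_char.
apply: (big_morph (fun x => x ^+ N)) => [x y|]; first exact: exprDn_pchar.
by rewrite expr0n gtn_eqF.
Qed.

Lemma card_powfix (L : finFieldType) N : (1 < N)%N ->
  (#|[pred y : L | y ^+ N == y]| <= N)%N.
Proof.
move=> N_gt1; rewrite cardE -ltnS.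
have szp : size ('X^N - 'X : {poly L}) = N.+1.
  by rewrite size_polyDl ?size_polyXn // size_polyN size_polyX ltnS.
rewrite -szp; apply: max_poly_roots; rewrite ?enum_uniq //.
  by rewrite -size_poly_eq0 szp.
apply/allP => y; rewrite mem_enum inE => /eqP yN.
by rewrite rootE !hornerE yN subrr.
Qed.

Lemma leq_card_fibers (T V : finType) (C : {set T}) (K : {pred V})
    (f : T -> V) N :
  (forall u, u \in C -> f u \in K) ->
  (forall u, u \in C -> #|[set v in C | f v == f u]| <= N)%N ->
  (#|C| <= N * #|K|)%N.
Proof.
move=> fK fN; rewrite -sum1_card (partition_big f (fun y => y \in K)) //=.
rewrite mulnC -sum_nat_const; apply: leq_sum => y yK.
case: (pickP [pred u | (u \in C) && (f u == y)]) => [u /andP[uC /eqP <-]|no_u].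
  by rewrite (leq_trans _ (fN u uC)) // -sum1_card;
    under [leqRHS]eq_bigl do rewrite inE.
by rewrite big_pred0.
Qed.

(** * Ideals of a ring cut into chain rings by orbit idempotents *)

(* In the application R = F[A x Z_n], phi is multiplication by q = |F| on A,  *)
(* pi = Y^(0,1) - 1, and chi a is the character of A indexed by a, extended   *)
(* trivially to Z_n.                                                          *)
Section ChainDecomposition.
Variables (A : finType) (phi : A -> A) (R : finComNzRingType).
Variables (L : finFieldType) (chi : A -> {rmorphism R -> L}) (pi : R).
Variables (q n : nat).
Hypothesis phi_inj : injective phi.
Hypothesis q_gt1 : (1 < q)%N.
Hypothesis n_pchar : [pchar R].-nat n.
Hypothesis chi_phi : forall a u, chi (phi a) u = chi a u ^+ q.
Hypothesis chi_ker : forall u, (forall a, chi a u = 0) -> exists v, u = pi * v.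
Hypothesis pi_nilp : pi ^+ n = 0.
Hypothesis chi_lift : forall D : {set A},
  (forall a, (phi a \in D) = (a \in D)) ->
  exists u, forall a, chi a u = (a \in D)%:R.
Hypothesis card_R : #|R| = (q ^ (#|A| * n))%N.

Let n_gt0 : (0 < n)%N. Proof. by case/andP: n_pchar. Qed.
Let conn_sym : connect_sym (frel phi) := fconnect_sym phi_inj.

(** The difference u - v is a multiple of pi, and the n-th power is additive and kills multiples of
    pi. *)
Lemma eq_expn_of_chi u v : (forall a, chi a u = chi a v) -> u ^+ n = v ^+ n.
Proof.
move=> uv; have [|w Dw] := chi_ker (u := u - v).
  by move=> a; rewrite rmorphB uv subrr.
rewrite -[u](subrK v) Dw exprDn_pchar // exprMn pi_nilp mul0r.
by rewrite add0r.
Qed.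

(* An arbitrary lift of the indicator of the orbit of a; its n-th power no    *)
(* longer depends on the lift.                                                *)
Definition pre_idem a : R :=
  odflt 0 [pick u | [forall b, chi b u == (fconnect phi a b)%:R]].

Definition idem a : R := pre_idem a ^+ n.

Lemma chi_pre_idem a b : chi b (pre_idem a) = (fconnect phi a b)%:R.
Proof.
rewrite /pre_idem; case: pickP => [u /forallP/(_ b)/eqP -> // | no_u] /=.
have [|u Du] := chi_lift (D := [set b | fconnect phi a b]).
  by move=> c; rewrite !inE -(same_fconnect1_r phi_inj).
have /negP[] := negbT (no_u u).
by apply/forallP=> c; rewrite Du inE.
Qed.

Lemma chi_idem a b : chi b (idem a) = (fconnect phi a b)%:R.
Proof.
rewrite rmorphXn /= chi_pre_idem.
by case: (fconnect _ _ _); rewrite ?expr1n // expr0n gtn_eqF.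
Qed.

Lemma idem_expn a : idem a ^+ n = idem a.
Proof. by apply: eq_expn_of_chi => b; rewrite chi_idem chi_pre_idem. Qed.

(** Reduces identities between the idempotents, which are fixed by the n-th power, to identities
    between values 0 and 1 in [L]. *)
Lemma eq_of_chi u v : u ^+ n = u -> v ^+ n = v ->
  (forall a, chi a u = chi a v) -> u = v.
Proof. by move=> un vn /eq_expn_of_chi; rewrite un vn. Qed.

Lemma idemM a b : idem a * idem b = (fconnect phi a b)%:R * idem a.
Proof.
apply: eq_of_chi => [||c].
- by rewrite exprMn !idem_expn.
- rewrite exprMn idem_expn.
  by case: (fconnect _ _ _); rewrite ?expr1n // expr0n gtn_eqF.
rewrite !rmorphM /= !chi_idem rmorph_nat -!natrM !mulnb; congr (_ %:R).
case ab: (fconnect phi a b); last first.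
  case ac: (fconnect phi a c) => //=; apply/eqP; rewrite eqb0.
  apply: contraFN ab => bc; apply: connect_trans ac _.
  by rewrite conn_sym.
by rewrite -(same_connect conn_sym ab) andbb.
Qed.

Lemma idem_idem a : idem a * idem a = idem a.
Proof. by rewrite idemM connect0 mul1r. Qed.

Lemma idem_fconnect a b : fconnect phi a b -> idem a = idem b.
Proof.
move=> ab; have := idemM a b; have := idemM b a.
by rewrite conn_sym ab mulrC !mul1r => -> ->.
Qed.

Lemma sum_idem : \sum_(a | froots phi a) idem a = 1.
Proof.
apply: eq_of_chi => [||b].
- by rewrite sum_exprn_pchar //; apply: eq_bigr => a _; apply: idem_expn.
- by rewrite expr1n.
rewrite rmorph_sum rmorph1 /= (bigD1 (froot phi b)) /=; last first.
  exact: roots_root.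
rewrite chi_idem conn_sym connect_root big1 ?addr0 // => a /andP[ra ab].
rewrite chi_idem -(root_connect conn_sym).
by move: ra ab; rewrite /roots /= => /eqP -> /negPf ->.
Qed.

Lemma chi_iter i a u : chi (iter i phi a) u = chi a u ^+ (q ^ i).
Proof. by elim: i => //= i IHi; rewrite chi_phi IHi -exprM -expnSr. Qed.

Lemma chi_eq0 a b u : fconnect phi a b -> chi a u = 0 -> chi b u = 0.
Proof.
move=> /iter_findex <- u0; rewrite chi_iter u0 expr0n gtn_eqF //.
by rewrite expn_gt0 ltnW.
Qed.

Lemma chi0_idemM a u : chi a u = 0 -> exists v, idem a * u = pi * v.
Proof.
move=> u0; apply: chi_ker => b; rewrite rmorphM /= chi_idem.
by case ab: (fconnect _ _ _); rewrite ?mul0r // (chi_eq0 ab) ?mulr0.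
Qed.

(** Nonzero elements of [L] have (|L| - 1)-th power 1, so that power of u has character 1 on the
    orbit of a; a further n-th power makes this exact on the component. *)
Lemma chi_neq0_unit a u : chi a u != 0 -> exists w, idem a * u * w = idem a.
Proof.
move=> u0; have L_gt1 := finNzRing_gt1 L.
have L1 : (#|L|.-1.+1 = #|L|)%N by rewrite prednK // (ltn_trans _ L_gt1).
have N_gt0 : (0 < #|L|.-1 * n)%N by rewrite muln_gt0 n_gt0 -ltnS L1 L_gt1.
exists (u ^+ (#|L|.-1 * n).-1).
rewrite -mulrA -exprS prednK // exprM -[idem a in LHS]idem_expn -exprMn.
rewrite -[RHS]idem_expn; apply: eq_expn_of_chi => b.
rewrite rmorphM rmorphXn /= chi_idem; case ab: (fconnect _ _ _);
  rewrite ?mul0r //.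
have v0 : chi b u != 0.
  by apply: contra u0 => /eqP; rewrite conn_sym in ab; move/(chi_eq0 ab)/eqP.
rewrite mul1r; apply: (mulIf v0).
by rewrite -exprSr L1 expf_card mul1r.
Qed.

(** The component of [idem a] is a chain ring: a factor pi is split off as long as the cofactor has
    character 0 at a, until the cofactor is invertible on the component or [pi ^+ n = 0] is reached.
    The multipliers v and w say that the two elements divide each other. *)
Lemma idem_valuation a u : exists t v w,
  idem a * u = idem a * pi ^+ t * v /\ idem a * pi ^+ t = idem a * u * w.
Proof.
suff: forall j, (exists t v w,
  idem a * u = idem a * pi ^+ t * v /\ idem a * pi ^+ t = idem a * u * w) \/
  exists v, idem a * u = idem a * pi ^+ j * v.
  case/(_ n) => // [[v]]; rewrite pi_nilp mulr0 mul0r => u0.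
  by exists n, 0, 0; rewrite u0 pi_nilp !(mulr0, mul0r).
elim=> [|j [|[v Du]]]; [by right; exists u; rewrite mulr1 | by left |].
have [v0|v0] := eqVneq (chi a v) 0.
  have [v' Dv'] := chi0_idemM v0; right; exists v'.
  rewrite Du -[idem a in LHS]idem_idem exprSr -!mulrA; congr (_ * _).
  by rewrite mulrCA Dv'.
have [w Dw] := chi_neq0_unit v0; left; exists j, v, w; split=> //.
by rewrite Du -!mulrA (mulrCA (idem a)) (mulrA (idem a)) Dw mulrC.
Qed.

(** * Ideals with prescribed exponents *)

(** The components are orthogonal, so for invariant s this one element generates the same ideal as
    all the [idem a * pi ^+ s a] together. *)
Definition pi_prod (s : A -> nat) : R :=
  \sum_(a | froots phi a) idem a * pi ^+ s a.

Definition pi_ideal s : {set R} := [set u | [exists r, u == pi_prod s * r]].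

Lemma pi_idealP s u : reflect (exists r, u = pi_prod s * r) (u \in pi_ideal s).
Proof.
by rewrite inE; apply: (iffP existsP) => [] [r /eqP]; exists r => //; apply/eqP.
Qed.

Lemma phi_invariant_fconnect (T : Type) (s : A -> T) a b :
  (forall a, s (phi a) = s a) -> fconnect phi a b -> s a = s b.
Proof.
move=> s_inv /iter_findex <-.
by elim: (findex _ _ _) => //= i ->; rewrite s_inv.
Qed.

Section Invariant.
Variable s : A -> nat.
Hypothesis s_inv : forall a, s (phi a) = s a.

Lemma idem_pi_prod a : idem a * pi_prod s = idem a * pi ^+ s a.
Proof.
rewrite /pi_prod mulr_sumr (bigD1 (froot phi a)) /=; last exact: roots_root.
rewrite mulrA idemM connect_root mul1r.
rewrite (phi_invariant_fconnect s_inv (connect_root _ a)).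
rewrite big1 ?addr0 // => b /andP[rb ab].
rewrite mulrA idemM -(root_connect conn_sym).
by move: rb ab; rewrite /roots /= => /eqP ->; rewrite eq_sym => /negPf ->;
  rewrite !mul0r.
Qed.

(** The idempotents sum to 1 and the generator acts as [pi ^+ s a] on the component of a, so
    membership can be tested component by component. *)
Lemma mem_pi_ideal u :
  u \in pi_ideal s <-> forall a, exists v, idem a * u = pi ^+ s a * v.
Proof.
split=> [/pi_idealP[r ->] a | u_pi].
  by exists (idem a * r); rewrite mulrA idem_pi_prod mulrAC mulrC.
have /fin_all_exists[v Dv] := u_pi.
apply/pi_idealP; exists (\sum_(a | froots phi a) idem a * v a).
rewrite mulr_sumr -[LHS]mul1r -sum_idem mulr_suml.
apply: eq_bigr => a _; rewrite -[in LHS]idem_idem -mulrA Dv.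
by rewrite [RHS]mulrCA [RHS]mulrA idem_pi_prod -mulrA.
Qed.

Lemma pi_ideal_ideal : is_ideal (pi_ideal s).
Proof.
apply/and3P; split.
- by apply/pi_idealP; exists 0; rewrite mulr0.
- apply/forall_inP => x /pi_idealP[r ->];
  apply/forall_inP => y /pi_idealP[r' ->].
  by apply/pi_idealP; exists (r - r'); rewrite mulrBr.
apply/forallP => a; apply/forall_inP => x /pi_idealP[r ->].
by apply/pi_idealP; exists (a * r); rewrite mulrCA.
Qed.

End Invariant.

Lemma mem_froot (D : {set A}) a : (forall b, (phi b \in D) = (b \in D)) ->
  (froot phi a \in D) = (a \in D).
Proof.
move=> D_inv; symmetry.
exact: (phi_invariant_fconnect (s := fun b => b \in D)) (connect_root _ a).
Qed.

Lemma sum_order (D : {set A}) : (forall a, (phi a \in D) = (a \in D)) ->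
  (\sum_(a in D | froots phi a) fingraph.order phi a)%N = #|D|.
Proof.
move=> D_inv; rewrite -[RHS]sum1_card.
rewrite [RHS](partition_big (froot phi)
  (fun a => (a \in D) && froots phi a)) /=; last first.
  move=> a aD; rewrite roots_root // andbT.
  by rewrite mem_froot.
apply: eq_bigr => a /andP[aD ra]; rewrite /fingraph.order -sum1_card;
  apply: eq_bigl => b.
have -> : (b \in fconnect phi a) = (froot phi a == froot phi b).
  by rewrite (root_connect conn_sym).
have /eqP -> := ra; rewrite eq_sym.
case: eqP => [Da|]; rewrite ?andbF // andbT.
by rewrite -(mem_froot b D_inv) Da.
Qed.

(** * Cardinality of the ideals *)

Section Step.
Variables s t : A -> nat.
Hypothesis s_inv : forall a, s (phi a) = s a.
Hypothesis t_inv : forall a, t (phi a) = t a.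
Let D := [set a | (s a < t a)%N].
Hypothesis st : forall a, t a = (s a + (a \in D))%N.

(** An element [pi_prod s * r] is sent to the values [chi a r], for one a in each orbit inside [D].
    Going once round an orbit of length d shows that such a value is fixed by the power q^d, and
    elements with equal values differ by an element of [pi_ideal t]. *)
Lemma card_pi_ideal_step : (#|pi_ideal s| <= #|pi_ideal t| * q ^ #|D|)%N.
Proof.
have D_inv a : (phi a \in D) = (a \in D) by rewrite !inE s_inv t_inv.
pose g u := odflt 0 [pick r | u == pi_prod s * r].
have gP u : u \in pi_ideal s -> u = pi_prod s * g u.
  rewrite inE /g => /existsP[r ur]; case: pickP => [r' /eqP //|/(_ r)].
  by rewrite ur.
pose E := [pred a | (a \in D) && froots phi a].
pose f u : {ffun A -> L} := [ffun a => if E a then chi a (g u) else 0].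
pose K := pfamily 0 E (fun a =>
  [pred y : L | y ^+ (q ^ fingraph.order phi a) == y]).
have K_le : (#|K| <= q ^ #|D|)%N.
  rewrite card_pfamily -(sum_order D_inv) foldrE big_map big_enum /=.
  rewrite expn_sum; apply: leq_prod => a /andP[aD ra]; apply: card_powfix.
  by rewrite -(exp1n (fingraph.order phi a)) ltn_exp2r ?fingraph.order_gt0.
apply: leq_trans (leq_mul (leqnn _) K_le).
apply: (leq_card_fibers (f := f)) => [u uC|u uC].
  apply/pfamilyP; split.
    by apply/supportP => a; rewrite ffunE inE /= => /negPf ->.
  move=> a aE; rewrite ffunE; move: (aE); rewrite inE /= => ->.
  by rewrite inE -chi_iter iter_order.
rewrite -(card_imset _ (addIr (- u)));
  apply/subset_leq_card/subsetP => _ /imsetP[v vP ->].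
have /setIdP[vC /eqP fvu] := vP.
rewrite (gP _ uC) (gP _ vC) -mulrBr.
pose r := g v - g u.
have r0 a : a \in D -> chi a r = 0.
  move=> aD; apply: (chi_eq0 (a := froot phi a)).
    by rewrite conn_sym connect_root.
  have /ffunP/(_ (froot phi a)) := fvu; rewrite !ffunE.
  rewrite /E /= roots_root // andbT.
  rewrite mem_froot // aD.
  by rewrite rmorphB => /= ->; rewrite subrr.
apply/(mem_pi_ideal t_inv) => a; rewrite mulrA (idem_pi_prod s_inv) st.
case aD: (a \in D); last by exists (idem a * r); rewrite addn0 mulrAC mulrC.
have [w Dw] := chi0_idemM (r0 a aD); exists w.
by rewrite mulrAC Dw mulrC addn1 exprSr mulrA.
Qed.
End Step.

(** Induction on the total gap: each step raises s by one wherever it is below t. *)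
Lemma card_pi_ideal_le s t :
  (forall a, s (phi a) = s a) -> (forall a, t (phi a) = t a) ->
  (forall a, s a <= t a)%N ->
  (#|pi_ideal s| <= #|pi_ideal t| * q ^ (\sum_a (t a - s a)))%N.
Proof.
move=> s_inv t_inv; have [N] := ubnP (\sum_a (t a - s a)).
elim: N s s_inv => // N IHN s s_inv ltN st.
pose D := [set a | (s a < t a)%N].
have [D0 | [a0 a0D]] := set_0Vmem D.
  have eq_st a : t a = s a.
    apply/eqP; rewrite eqn_leq st andbT leqNgt.
    by have := in_set0 a; rewrite -D0 inE => ->.
  rewrite big1 ?muln1; last by move=> a _; rewrite eq_st subnn.
  suff -> : pi_ideal s = pi_ideal t by [].
  apply/setP => u; rewrite !inE; apply: eq_existsb => r.
  by rewrite /pi_prod; under [in RHS]eq_bigr do rewrite eq_st.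
pose s' a := (s a + (a \in D))%N.
have s'_inv a : s' (phi a) = s' a by rewrite /s' !inE s_inv t_inv.
have ss' : [set a | (s a < s' a)%N] = D.
  by apply/setP=> a; rewrite inE /s'; case: (a \in D);
    rewrite ?addn1 ?addn0 ?ltnn ?ltnSn.
have Dsum : (\sum_a (t a - s a) = \sum_a (t a - s' a) + #|D|)%N.
  rewrite -sum1_card [X in (_ + X)%N]big_mkcond -big_split /=.
  apply: eq_bigr => a _; rewrite /s'.
  case: ifPn => [|_]; rewrite ?addn0 // inE => lt_st.
  by rewrite !addn1 subnSK.
have := card_pi_ideal_step s_inv s'_inv; rewrite ss' => /(_ (fun a => erefl)).
move/leq_trans; apply; rewrite Dsum expnD mulnA leq_mul2r.
apply/orP; right; apply: IHN => //.
  move: ltN; rewrite Dsum ltnS; apply: leq_trans; rewrite -addn1 leq_add2l.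
  by apply/card_gt0P; exists a0.
move=> a; rewrite /s' inE; case: ltnP => [lt_st|_]; last by rewrite addn0.
by rewrite addn1.
Qed.

(* The bounds for the chain from s to n and for the chain from 0 to s multiply *)
(* up to #|R|, so both are equalities. *)
Lemma card_pi_ideal s : (forall a, s (phi a) = s a) -> (forall a, s a <= n)%N ->
  #|pi_ideal s| = (q ^ (\sum_a (n - s a)))%N.
Proof.
move=> s_inv s_n; apply/eqP; rewrite eqn_leq; apply/andP; split.
  have := card_pi_ideal_le (t := fun=> n) s_inv (fun=> erefl) s_n.
  suff -> : pi_ideal (fun=> n) = [set 0] by rewrite cards1 mul1n.
  apply/setP => u; rewrite inE in_set1.
  have -> : pi_prod (fun=> n) = 0.
    by rewrite /pi_prod big1 // => a _; rewrite pi_nilp mulr0.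
  by apply/existsP/eqP => [[r /eqP ->]|->]; [|exists 0]; rewrite mul0r.
have := card_pi_ideal_le (s := fun=> 0%N) (fun=> erefl) s_inv (fun=> leq0n _).
have -> : pi_ideal (fun=> 0%N) = setT.
  apply/setP => u; rewrite !inE; apply/existsP; exists u.
  rewrite /pi_prod; under eq_bigr do rewrite mulr1.
  by rewrite sum_idem mul1r.
rewrite cardsT card_R => le_R.
have Dsum : (\sum_(a : A) n = #|A| * n)%N by rewrite sum_nat_const.
rewrite -(@leq_pmul2r (q ^ (\sum_a s a))) ?expn_gt0 ?(ltnW q_gt1) //.
rewrite -expnD -big_split /=.
under [X in (q ^ X <= _)%N]eq_bigr do rewrite subnK //.
rewrite Dsum; apply: leq_trans le_R _.
by under eq_bigr do rewrite subn0.
Qed.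

(** If [idem a * pi ^+ n.-1] vanished, the ideal with exponent n - 1 on the orbit of a and n
    elsewhere would be zero, but its cardinality is a positive power of q. *)
Lemma idem_pi_neq0 a j : (j < n)%N -> idem a * pi ^+ j != 0.
Proof.
move=> j_n; suff: idem a * pi ^+ n.-1 != 0.
  apply: contra => /eqP e0; rewrite -(subnKC (_ : j <= n.-1)%N).
    by rewrite exprD mulrA e0 mul0r.
  by rewrite -ltnS prednK.
apply/eqP => e0.
pose s b := if fconnect phi a b then n.-1 else n.
have s_inv b : s (phi b) = s b by rewrite /s -(same_fconnect1_r phi_inj).
have s_n b : (s b <= n)%N by rewrite /s; case: ifP; rewrite ?leq_pred.
have := card_pi_ideal s_inv s_n.
have -> : pi_ideal s = [set 0].
  apply/setP => u; rewrite in_set1; apply/idP/eqP => [/pi_idealP[r ->]|->].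
    rewrite /pi_prod big1 ?mul0r // => b _; rewrite /s.
    by case: ifP => [/idem_fconnect <- //|]; rewrite pi_nilp mulr0.
  by apply/pi_idealP; exists 0; rewrite mulr0.
rewrite cards1 (bigD1 a) //= {1}/s connect0 -{1}(prednK n_gt0) subSnn =>
  /esym/eqP.
by rewrite -[1%N](expn0 q) eqn_exp2l.
Qed.

(** If [idem a * u] has valuation t, annihilation by [pi ^+ j] forces n <= t + j, since the powers
    of pi below n do not vanish on the component. *)
Lemma idem_pi_mul_eq0 a j u : (j <= n)%N ->
  (exists v, idem a * u = pi ^+ (n - j) * v) <-> idem a * pi ^+ j * u = 0.
Proof.
move=> j_n; split=> [[v Dv] | u0].
  by rewrite mulrAC Dv mulrAC -exprD subnK // pi_nilp mul0r.
have [t [v [w [Dv Dw]]]] := idem_valuation a u.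
have le_n : (n - j <= t)%N.
  rewrite leq_subLR leqNgt; apply/negP => lt_n.
  move: (idem_pi_neq0 a lt_n); rewrite exprD [pi ^+ j * _]mulrC mulrA Dw.
  by rewrite mulrAC [idem a * u * _]mulrAC u0 mul0r eqxx.
exists (idem a * pi ^+ (t - (n - j)) * v).
by rewrite Dv !mulrA; congr (_ * v); rewrite [RHS]mulrAC -exprD subnKC // mulrC.
Qed.

Lemma idem_pi_mem s a j : (forall a, s (phi a) = s a) -> (j < n)%N ->
  idem a * pi ^+ j \in pi_ideal s -> (s a <= j)%N.
Proof.
move=> s_inv j_n /(mem_pi_ideal s_inv)/(_ a)[v]; rewrite mulrA idem_idem => Dv.
rewrite leqNgt; apply/negP => lt_js.
(* As s is not bounded by n here, [n - s a] may be truncated to 0. *)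
have jn : (n - s a + j < n)%N.
  case: (leqP (s a) n) => [s_n | /ltnW/eqP ->]; last by rewrite add0n.
  by rewrite -[X in (_ < X)%N](subnK s_n) ltn_add2l.
have := idem_pi_neq0 a jn; rewrite addnC exprD mulrA Dv mulrAC -exprD.
have le_n : (n <= s a + (n - s a))%N by rewrite -leq_subLR.
by rewrite -(subnKC le_n) exprD pi_nilp !mul0r eqxx.
Qed.

Lemma pi_ideal_inj s t :
  (forall a, s (phi a) = s a) -> (forall a, t (phi a) = t a) ->
  (forall a, s a <= n)%N -> (forall a, t a <= n)%N ->
  pi_ideal s = pi_ideal t -> s =1 t.
Proof.
suff le s' t' : (forall a, s' (phi a) = s' a) ->
    (forall a, t' (phi a) = t' a) -> (forall a, t' a <= n)%N ->
    pi_ideal s' = pi_ideal t' -> forall a, (t' a <= s' a)%N.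
  move=> s_inv t_inv s_n t_n st a; apply/eqP.
  by rewrite eqn_leq (le t s) // (le s t).
move=> s_inv t_inv t_n st a; case: (leqP n (s' a)) => [|s_lt].
  exact: leq_trans (t_n a).
apply: idem_pi_mem => //; rewrite -st -idem_pi_prod //.
by apply/pi_idealP; exists (idem a); rewrite mulrC.
Qed.

(** * Every ideal comes from exponents *)

(** The least j with [idem a * pi ^+ j] in [C]; [find] yields n if there is none below n, as fits
    [pi ^+ n = 0]. *)
Definition ideal_exp (C : {set R}) a :=
  find [pred j | idem a * pi ^+ j \in C] (iota 0 n).

Section Ideal.
Variable C : {set R}.
Hypothesis C_ideal : is_ideal C.

Lemma ideal0 : 0 \in C. Proof. by case/and3P: C_ideal. Qed.

Lemma idealMl r u : u \in C -> r * u \in C.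
Proof. by case/and3P: C_ideal => _ _ /forallP/(_ r)/forall_inP; apply. Qed.

Lemma idealD u v : u \in C -> v \in C -> u + v \in C.
Proof.
move=> uC vC; case/and3P: C_ideal => _ /forall_inP/(_ u uC)/forall_inP CB _.
by rewrite -[v]opprK CB // -mulN1r idealMl.
Qed.

Lemma ideal_exp_le a : (ideal_exp C a <= n)%N.
Proof. by rewrite -[leqRHS](size_iota 0 n) find_size. Qed.

Lemma idem_pi_ideal_exp a : idem a * pi ^+ ideal_exp C a \in C.
Proof.
have := ideal_exp_le a; rewrite leq_eqVlt => /predU1P[->|lt_n].
  by rewrite pi_nilp mulr0 ideal0.
have := lt_n;
  rewrite -[X in (_ < X)%N](size_iota 0 n) -has_find => /(nth_find 0%N) /=.
by rewrite nth_iota.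
Qed.

Lemma ideal_exp_min a j : idem a * pi ^+ j \in C -> (ideal_exp C a <= j)%N.
Proof.
move=> jC; rewrite leqNgt; apply/negP => lt_j.
have lt_jn : (j < n)%N by apply: leq_trans (ideal_exp_le a).
have := before_find 0%N lt_j; rewrite /= nth_iota // add0n => /negbT/negP.
by case.
Qed.

Lemma ideal_exp_phi a : ideal_exp C (phi a) = ideal_exp C a.
Proof. by rewrite /ideal_exp (idem_fconnect (fconnect1 phi a)). Qed.

(** By the valuation, each component of u in [C] is associate to some [idem a * pi ^+ t], which then
    lies in [C] too, so t is at least the exponent of [C] at a. *)
Lemma ideal_eq_pi_ideal : C = pi_ideal (ideal_exp C).
Proof.
apply/setP => u; apply/idP/idP => [uC | /pi_idealP[r ->]].
  apply/(mem_pi_ideal ideal_exp_phi) => a.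
  have [t [v [w [Dv Dw]]]] := idem_valuation a u.
  have /ideal_exp_min le_t : idem a * pi ^+ t \in C.
    by rewrite Dw mulrAC idealMl.
  exists (idem a * pi ^+ (t - ideal_exp C a) * v).
  by rewrite Dv !mulrA; congr (_ * v);
    rewrite [RHS]mulrAC -exprD subnKC // mulrC.
rewrite mulrC idealMl // /pi_prod.
elim/big_rec: _ => [|a x _ xC]; first exact: ideal0.
by rewrite idealD ?idem_pi_ideal_exp.
Qed.

End Ideal.

Definition exponents : {set {ffun A -> 'I_n.+1}} :=
  [set s : {ffun A -> 'I_n.+1} | [forall a, s (phi a) == s a]].

Lemma exponentsP (s : {ffun A -> 'I_n.+1}) :
  reflect (forall a, s (phi a) = s a) (s \in exponents).
Proof. by rewrite inE; apply: forallPP => a; apply: eqP. Qed.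

(** With f arbitrary the bijection serves twice: f = 1 counts the codes, and f can be the hull
    dimension. *)
Lemma sum_ideals (f : {set R} -> nat) :
  (\sum_(C : {set R} | is_ideal C) f C =
   \sum_(s in exponents) f (pi_ideal (fun a => s a)))%N.
Proof.
have -> : (\sum_(C : {set R} | is_ideal C) f C = \sum_(C in
      [set pi_ideal (fun a => (s : {ffun A -> 'I_n.+1}) a) | s in exponents])
    f C)%N.
  apply: eq_bigl => C; apply/idP/imsetP => [C_ideal | [s _ ->]].
    exists [ffun a => inord (ideal_exp C a)].
      by apply/exponentsP => a; rewrite !ffunE ideal_exp_phi.
    rewrite [LHS]ideal_eq_pi_ideal //; apply/setP => u; rewrite !inE.
    apply: eq_existsb => r; rewrite /pi_prod.
    by under [in RHS]eq_bigr do rewrite ffunE inordK ?ltnS ?ideal_exp_le //.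
  exact: pi_ideal_ideal.
rewrite big_imset //= => s t /exponentsP s_inv /exponentsP t_inv st.
apply/ffunP => a; apply/val_inj; move: a; apply: (pi_ideal_inj _ _ _ _ st) => a.
- by rewrite s_inv.
- by rewrite t_inv.
- exact: leq_ord.
exact: leq_ord.
Qed.

Lemma pi_idealI s t : (forall a, s (phi a) = s a) ->
  (forall a, t (phi a) = t a) ->
  pi_ideal s :&: pi_ideal t = pi_ideal (fun a => maxn (s a) (t a)).
Proof.
move=> s_inv t_inv.
have m_inv a : maxn (s (phi a)) (t (phi a)) = maxn (s a) (t a).
  by rewrite s_inv t_inv.
apply/setP => u; rewrite inE; apply/andP/idP => [[us ut] | um].
  apply/(mem_pi_ideal m_inv) => a.
  have [v Dv] := (mem_pi_ideal s_inv u).1 us a.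
  have [w Dw] := (mem_pi_ideal t_inv u).1 ut a.
  by case: leqP => _; [exists w | exists v].
split; [apply/(mem_pi_ideal s_inv) | apply/(mem_pi_ideal t_inv)] => a;
  have [v Dv] := (mem_pi_ideal m_inv u).1 um a.
  by exists (pi ^+ (maxn (s a) (t a) - s a) * v);
    rewrite mulrA -exprD subnKC ?leq_maxl.
by exists (pi ^+ (maxn (s a) (t a) - t a) * v);
  rewrite mulrA -exprD subnKC ?leq_maxr.
Qed.

(** * Annihilators twisted by an involution *)

Section Duality.
Variables (star : R -> R) (nu : A -> A) (w : R).
Hypothesis starK : involutive star.
Hypothesis starM : forall u v, star (u * v) = star u * star v.
Hypothesis star1 : star 1 = 1.
Hypothesis nuK : involutive nu.
Hypothesis nu_phi : forall a, nu (phi a) = phi (nu a).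
Hypothesis chi_star : forall a u, chi a (star u) = chi (nu a) u.
Hypothesis star_pi : star pi = pi * w.

Lemma starX u j : star (u ^+ j) = star u ^+ j.
Proof. by elim: j => [|j IHj]; rewrite ?expr0 // !exprS starM IHj. Qed.

Lemma nu_fconnect a b : fconnect phi (nu a) (nu b) = fconnect phi a b.
Proof.
suff le c d : fconnect phi c d -> fconnect phi (nu c) (nu d).
  by apply/idP/idP => /le //; rewrite !nuK.
move=> /iter_findex <-.
have -> i : nu (iter i phi c) = iter i phi (nu c) by elim: i => //= i <-.
exact: fconnect_iter.
Qed.

Lemma star_idem a : star (idem a) = idem (nu a).
Proof.
apply: eq_of_chi; rewrite -?starX ?idem_expn // => b.
by rewrite chi_star !chi_idem -[b in RHS]nuK nu_fconnect.
Qed.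

(** [star] exchanges the components of a and [nu a] and sends pi to a multiple of itself, while on
    one component the annihilator of [pi ^+ j] is generated by [pi ^+ (n - j)]. *)
Lemma annihilator_pi_ideal s : (forall a, s (phi a) = s a) ->
  (forall a, s a <= n)%N ->
  [set v | [forall c in pi_ideal s, c * star v == 0]] =
  pi_ideal (fun a => n - s (nu a))%N.
Proof.
move=> s_inv s_n.
have t_inv a : (n - s (nu (phi a)) = n - s (nu a))%N by rewrite nu_phi s_inv.
have pi_star : pi = star pi * star w by rewrite -starM -star_pi starK.
apply/setP => v; rewrite inE; apply/idP/idP => [/forall_inP ann | vP].
  apply/(mem_pi_ideal t_inv) => a.
  have /idem_pi_mul_eq0 : idem (nu a) * pi ^+ s (nu a) * star v = 0.
    apply/eqP/ann/pi_idealP; exists (idem (nu a)).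
    by rewrite -idem_pi_prod // mulrC.
  case=> // r Dr; exists (w ^+ (n - s (nu a)) * star r).
  rewrite -[idem a * v]starK starM star_idem Dr starM starX star_pi exprMn.
  by rewrite mulrA.
apply/forall_inP => _ /pi_idealP[r ->]; apply/eqP.
suff P0 : pi_prod s * star v = 0 by rewrite mulrAC P0 mul0r.
rewrite /pi_prod mulr_suml big1 // => a _.
apply/idem_pi_mul_eq0 => //.
have [r' Dr] := (mem_pi_ideal t_inv v).1 vP (nu a); rewrite nuK in Dr.
exists (w ^+ (n - s a) * star r').
by rewrite -[a in idem a]nuK -star_idem -starM Dr starM starX star_pi exprMn
  mulrA.
Qed.

Lemma card_pi_ideal_hull s : (forall a, s (phi a) = s a) ->
  (forall a, s a <= n)%N ->
  #|pi_ideal s :&: [set v | [forall c in pi_ideal s, c * star v == 0]]| =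
  (q ^ (\sum_a (n - maxn (s a) (n - s (nu a)))))%N.
Proof.
move=> s_inv s_n; rewrite annihilator_pi_ideal // pi_idealI // => [|a];
  last first.
  by rewrite nu_phi s_inv.
rewrite card_pi_ideal // => a; first by rewrite nu_phi !s_inv.
by rewrite geq_max s_n leq_subr.
Qed.

End Duality.
End ChainDecomposition.

(* Translating by a preimage of y shows that the fibres of ev on X all have   *)
(* the same size.                                                             *)
Lemma sum_eval_surj (I : finType) (V W : finZmodType) (X : {set {ffun I -> V}})
    (ev : {ffun I -> V} -> W) (g : W -> nat) :
  (forall s t, t \in X -> (s + t \in X) = (s \in X)) ->
  (forall s t, ev (s + t) = ev s + ev t) ->
  (forall y, exists2 t, t \in X & ev t = y) ->
  (#|W| * \sum_(s in X) g (ev s) = #|X| * \sum_y g y)%N.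
Proof.
move=> XD evD ev_surj; rewrite -[RHS]sum_nat_const -[LHS]sum_nat_const.
transitivity (\sum_(y : W) \sum_(s in X) g (ev s + y)%R)%N.
  apply: eq_bigr => y _; have [t tX <-] := ev_surj y.
  rewrite (reindex_inj (addIr t)) /=.
  by apply: eq_big => [s | s _]; rewrite ?XD ?evD.
rewrite exchange_big; apply: eq_bigr => s _ /=.
by rewrite [RHS](reindex_inj (addrI (ev s))).
Qed.

(** * Two sums over exponents *)

(** Each summand is min(i, n - i). From n to n + 2, two zero end terms appear and the n + 1 inner
    ones grow by one. *)
Lemma sum_min_diag n :
  (4 * \sum_(i < n.+1) (n - maxn i (n - i)) + odd n = n ^ 2)%N.
Proof.
elim/ltn_ind: n => -[|[|n]] IHn; first by rewrite big_ord1.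
  by rewrite !big_ord_recl big_ord0.
rewrite big_ord_recl big_ord_recr /=.
under eq_bigr => i _.
  have -> : (n.+2 - maxn (bump 0 i) (n.+2 - bump 0 i) =
             (n - maxn i (n - i)) + 1)%N.
    by rewrite /bump /=; have := leq_ord i; lia.
  over.
rewrite big_split /= sum_nat_const card_ord.
have := IHn n (leqnSn _); rewrite /bump /=; lia.
Qed.

(** The double sum is 1^2 + ... + n^2: once j is reversed, passing from n to n + 1 adds a zero row
    and column and raises the other (n + 1)^2 terms by one. *)
Lemma sum_min_pair n :
  (6 * \sum_(i < n.+1) \sum_(j < n.+1) (n - maxn i (n - j)) =
   n * n.+1 * (2 * n + 1))%N.
Proof.
under eq_bigr => i _.
  (* j |-> n - j turns the summand into n - maxn i j *)
  rewrite (reindex_inj rev_ord_inj) /=.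
  under eq_bigr => j _ do rewrite subSS subKn ?leq_ord //.
  over.
elim: n => [|n IHn]; first by rewrite !big_ord1.
rewrite big_ord_recr /= [X in (_ + X)%N]big1 ?addn0; last first.
  by move=> j _; rewrite (maxn_idPl _) ?subnn // -ltnS.
under eq_bigr => i _.
  rewrite big_ord_recr /= [X in (_ + X)%N](_ : _ = 0%N); last by lia.
  under eq_bigr => j _.
    have -> : (n.+1 - maxn i j = (n - maxn i j) + 1)%N.
      by have := leq_ord i; have := leq_ord j; lia.
    over.
  rewrite big_split /= sum_nat_const card_ord addn0.
  over.
rewrite big_split /= sum_nat_const card_ord mulnDr IHn; lia.
Qed.

(** * Averaging over invariant exponent functions *)

Section Average.
Variables (A : finType) (phi nu : A -> A) (n : nat).
Hypothesis phi_inj : injective phi.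
Local Notation X := (exponents phi n).
Let overlap (i j : 'I_n.+1) := (n - maxn i (n - j))%N.

(** Addition modulo n + 1 on exponents has no counterpart for ideals; it makes the invariant
    functions a group, so that evaluation at points has fibres of equal size. *)
Lemma exponentsD (s t : {ffun A -> 'I_n.+1}) : t \in X ->
  (s + t \in X) = (s \in X).
Proof.
move=> /exponentsP t_inv; apply/exponentsP/exponentsP => s_inv a.
  by apply: (addIr (t a)); have := s_inv a; rewrite !ffunE t_inv.
by rewrite !ffunE s_inv t_inv.
Qed.

Lemma sum_overlap_conj a : fconnect phi a (nu a) ->
  (n.+1 * \sum_(s in X) overlap (s a) (s (nu a)) = #|X| * \sum_i overlap i i)%N.
Proof.
move=> a_nu.
have eq_s (s : {ffun A -> 'I_n.+1}) : s \in X -> s (nu a) = s a.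
  by move=> /exponentsP s_inv; rewrite (phi_invariant_fconnect s_inv a_nu).
under eq_bigr => s sX do rewrite eq_s //.
have := @sum_eval_surj A 'I_n.+1 'I_n.+1 X
  (fun s => s a) (fun i => overlap i i).
rewrite card_ord; apply=> [s t|s t|y]; first exact: exponentsD.
  by rewrite ffunE.
by exists [ffun=> y]; rewrite ?ffunE //; apply/exponentsP => b; rewrite !ffunE.
Qed.

Lemma sum_overlap_nconj a : ~~ fconnect phi a (nu a) ->
  (n.+1 ^ 2 * \sum_(s in X) overlap (s a) (s (nu a)) =
   #|X| * \sum_i \sum_j overlap i j)%N.
Proof.
move=> a_nu; rewrite pair_big /=.
have := @sum_eval_surj A 'I_n.+1 ('I_n.+1 * 'I_n.+1)%type X
  (fun s => (s a, s (nu a))) (fun y => overlap y.1 y.2).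
rewrite card_prod card_ord mulnn; apply=> [s t|s t|[y z]];
  first exact: exponentsD.
  by rewrite !ffunE.
(* The two orbits are disjoint, so y and z can be prescribed independently. *)
exists [ffun b => if fconnect phi a b then y else
                  if fconnect phi (nu a) b then z else 0].
  by apply/exponentsP => b; rewrite !ffunE -!(same_fconnect1_r phi_inj).
by rewrite !ffunE connect0 (negPf a_nu) connect0.
Qed.

Lemma sum_overlap :
  (n.+1 ^ 2 * \sum_(s in X) \sum_a overlap (s a) (s (nu a)) =
   #|X| * (#|[set a | fconnect phi a (nu a)]| * (n.+1 * \sum_i overlap i i) +
     (#|A| - #|[set a | fconnect phi a (nu a)]|) *
       \sum_i \sum_j overlap i j))%N.
Proof.
set Q := [set a | _]; rewrite exchange_big big_distrr /=.
have -> : (#|A| - #|Q| = #|~: Q|)%N by rewrite -(cardsC Q) addKn.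
rewrite (bigID (mem Q)) /= mulnDr; congr (_ + _)%N.
  rewrite mulnCA -[RHS]sum_nat_const; apply: eq_bigr => a; rewrite inE => aQ.
  by rewrite -mulnn -mulnA sum_overlap_conj // mulnCA.
rewrite mulnCA -[RHS]sum_nat_const.
by apply: eq_big => a; rewrite !inE // => aQ; rewrite sum_overlap_nconj.
Qed.

End Average.

(** * Monomials and the involution of the group algebra *)

Section GroupAlgebraTheory.
Variables (F : finFieldType) (G : finZmodType).
Implicit Types (u v c : galg F G) (g h : G).

Definition monom g : galg F G := galg_of (fun h => (h == g)%:R).

Lemma galg_coef0 g : coef (0 : galg F G) g = 0.
Proof. exact: ffunE. Qed.

Lemma galg_coefB u v g : coef (u - v) g = coef u g - coef v g.
Proof. by rewrite Defs.coefD -[- v]scaleN1r Defs.coefZ mulN1r. Qed.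

Lemma galg_coef_sum (I : Type) (r : seq I) (P : pred I) (U : I -> galg F G) g :
  coef (\sum_(i <- r | P i) U i) g = \sum_(i <- r | P i) coef (U i) g.
Proof.
apply: (big_morph (fun u => coef u g)) => [u v|]; first exact: Defs.coefD.
exact: ffunE.
Qed.

Lemma coef_monomM u g h : coef (u * monom g) h = coef u (h - g).
Proof.
rewrite galg_ofE (bigD1 (h - g)) //= galg_ofE subKr eqxx mulr1.
rewrite big1 ?addr0 // => k kP; rewrite galg_ofE.
case: eqP => [hk|_]; rewrite ?mulr0 //.
by case/eqP: kP; rewrite -hk subKr.
Qed.

Lemma monomD g h : monom (g + h) = monom g * monom h.
Proof.
by apply/galgP => k; rewrite coef_monomM !galg_ofE subr_eq.
Qed.

Lemma monom0 : monom 0 = 1.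
Proof. by apply/galgP => h; rewrite !galg_ofE. Qed.

Lemma monomMn g j : monom (g *+ j) = monom g ^+ j.
Proof. by elim: j => [|j IHj]; rewrite ?monom0 // exprS mulrS monomD IHj. Qed.

Lemma galg_sum_monom u : u = \sum_g coef u g *: monom g.
Proof.
apply/galgP => h;
  rewrite galg_coef_sum (bigD1 h) //= Defs.coefZ galg_ofE eqxx mulr1.
rewrite big1 ?addr0 // => g gh; rewrite Defs.coefZ galg_ofE eq_sym (negPf gh).
by rewrite mulr0.
Qed.

(** The involution sending Y^g to Y^(-g); the Euclidean product of u and v is the coefficient of
    [u * star v] at 0. *)
Definition star u : galg F G := galg_of (fun g => coef u (- g)).

Lemma starK : involutive star.
Proof. by move=> u; apply/galgP => g; rewrite !galg_ofE opprK. Qed.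

Lemma starM u v : star (u * v) = star u * star v.
Proof.
apply/galgP => g; rewrite !galg_ofE (reindex_inj oppr_inj) /=.
by apply: eq_bigr => h _; rewrite !galg_ofE opprB opprK addrC.
Qed.

Lemma star_monom g : star (monom g) = monom (- g).
Proof. by apply/galgP => h; rewrite !galg_ofE eqr_oppLR. Qed.

Lemma star1 : star 1 = 1.
Proof. by rewrite -monom0 star_monom oppr0. Qed.

Lemma starB u v : star (u - v) = star u - star v.
Proof.
by apply/galgP => g; rewrite galg_ofE !galg_coefB !galg_ofE.
Qed.

(** The coefficient of [c * star v] at g is the product of v with a translate of c, which lies in
    [C] again, so orthogonality to [C] amounts to annihilation. *)
Lemma euclid_dual_ideal (C : {set galg F G}) : is_ideal C ->
  euclid_dual C = [set v | [forall c in C, c * star v == 0]].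
Proof.
move=> C_ideal; apply/setP => v; rewrite !inE.
have coefE c g : coef (c * star v) g = euclid (c * monom (- g)) v.
  rewrite galg_ofE /euclid (reindex_inj (addIr g)) /=.
  apply: eq_bigr => h _; rewrite coef_monomM opprK galg_ofE.
  by rewrite opprB addrK.
apply/forall_inP/forall_inP => vC c cC; apply/eqP.
  apply/galgP => g; rewrite coefE (eqP (vC _ _)); first by rewrite galg_coef0.
  by rewrite mulrC (idealMl C_ideal).
by have := coefE c 0; rewrite oppr0 monom0 mulr1 (eqP (vC _ cC)) galg_coef0.
Qed.

Lemma card_submod (C : {set galg F G}) : submod_closed C ->
  #|C| = (#|F| ^ dimF C)%N.
Proof.
move=> /span_subspace C_span.
by rewrite /dimF -card_vspace; apply: eq_card => u; rewrite C_span.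
Qed.


End GroupAlgebraTheory.

(** * Characters of the group algebra *)

(** [X^|F| - X] is the product of all X - x with x in [F], so its roots in [L] come from [F]. *)
Lemma finField_fixed (F L : finFieldType) (iota : {rmorphism F -> L}) (y : L) :
  y ^+ #|F| = y -> exists x, y = iota x.
Proof.
move=> yF.
have: root (map_poly iota ('X^#|F| - 'X)) y.
  by rewrite rmorphB /= map_polyXn map_polyX rootE !hornerE yF subrr.
rewrite finField_genPoly rmorph_prod /= rootE horner_prod => /prodf_eq0[x _].
by rewrite map_polyXsubC !hornerE subr_eq0 => /eqP ->; exists x.
Qed.

Section Characters.
Variables (F L : finFieldType) (iota : {rmorphism F -> L}).
Variables (A Z : finZmodType) (B : A -> A -> L).
Hypothesis BC : forall a b, B a b = B b a.
Hypothesis BD : forall a a' b, B (a + a') b = B a b * B a' b.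
Hypothesis B0 : forall b, B 0 b = 1.
Hypothesis B_nondeg : forall a, a != 0 -> exists b, B a b != 1.
Hypothesis A_neq0 : #|A|%:R != 0 :> L.
Local Notation R := (galg F (A * Z)%type).

(** Translating the sum by some b with [B a b != 1] multiplies it by [B a b], so it vanishes for
    nonzero a. *)
Lemma pairing_sum a : \sum_b B a b = (a == 0)%:R * #|A|%:R.
Proof.
case: eqP => [->|/eqP /B_nondeg[b Bab]].
  by rewrite (eq_bigr (fun=> 1)) // sumr_const mul1r.
rewrite mul0r; apply/eqP.
have : (B a b - 1) * (\sum_b B a b) == 0.
  rewrite mulrBl mul1r subr_eq0 mulr_sumr; apply/eqP.
  rewrite [RHS](reindex_inj (addrI b)) /=; apply: eq_bigr => c _.
  by rewrite [B a (b + c)]BC BD -!(BC a).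
by rewrite mulf_eq0 subr_eq0 (negPf Bab).
Qed.

Lemma pairingN a b : B (- a) b = B a (- b).
Proof.
have Bab0 : B a b != 0.
  by apply/eqP => Bab; have := B0 b; rewrite -(subrr a) BD Bab mul0r => /eqP;
    rewrite eq_sym oner_eq0.
by apply: (mulfI Bab0); rewrite -BD subrr B0 ![B a _]BC -BD subrr B0.
Qed.

Lemma pairingMn a b j : B (a *+ j) b = B a b ^+ j.
Proof. by elim: j => [|j IHj]; rewrite ?B0 // mulrS exprS BD IHj. Qed.

(** The factor [Z] is sent to 1: a cyclic group of order p^k has no other character in
    characteristic p. *)
Definition char_fun a (u : R) : L := \sum_g iota (coef u g) * B a g.1.

Lemma char_fun_zmod_morphism a : zmod_morphism (char_fun a).
Proof.
move=> u v; rewrite /char_fun -sumrB; apply: eq_bigr => g _.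
by rewrite galg_coefB rmorphB mulrBl.
Qed.

Lemma char_fun_monoid_morphism a : monoid_morphism (char_fun a).
Proof.
split=> [|u v].
  rewrite /char_fun (bigD1 0) //= galg_ofE eqxx rmorph1 mul1r BC B0.
  by rewrite big1 ?addr0 // => g /negPf g0; rewrite galg_ofE g0 rmorph0 mul0r.
rewrite /char_fun mulr_suml.
under eq_bigr => g _ do rewrite galg_ofE rmorph_sum mulr_suml.
rewrite exchange_big; apply: eq_bigr => h _ /=.
rewrite mulr_sumr (reindex_inj (addrI h)) /=; apply: eq_bigr => g _.
by rewrite rmorphM [_ + g]addrC addrK [B a (_ + _)]BC BD -!(BC a) mulrACA.
Qed.

Definition char a : {rmorphism R -> L} :=
  HB.pack (char_fun a)
    (GRing.isZmodMorphism.Build R L (char_fun a) (char_fun_zmod_morphism a))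
    (GRing.isMonoidMorphism.Build R L (char_fun a)
      (char_fun_monoid_morphism a)).

Lemma charE a u : char a u = \sum_g iota (coef u g) * B a g.1.
Proof. by []. Qed.

Lemma char_monom a g : char a (monom F g) = B a g.1.
Proof.
rewrite charE (bigD1 g) //= galg_ofE eqxx rmorph1 mul1r big1 ?addr0 // => h.
by move=> /negPf gh; rewrite galg_ofE gh rmorph0 mul0r.
Qed.

Lemma char_scale a c u : char a (c *: u) = iota c * char a u.
Proof.
rewrite !charE mulr_sumr; apply: eq_bigr => g _.
by rewrite Defs.coefZ rmorphM mulrA.
Qed.

Lemma char_star a u : char a (star u) = char (- a) u.
Proof.
rewrite !charE (reindex_inj oppr_inj) /=; apply: eq_bigr => g _.
by rewrite galg_ofE opprK pairingN.
Qed.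

(** Fourier inversion on [A]: weighting [char a u] by [B a (- b)] and summing over a gives |A| times
    the coefficient sum over the fibre of b. *)
Lemma char_kernel_sum u b : (forall a, char a u = 0) ->
  \sum_(g | g.1 == b) coef u g = 0.
Proof.
move=> u0; apply/eqP; rewrite -(fmorph_eq0 iota) rmorph_sum /=.
rewrite -(inj_eq (mulIf A_neq0)) mul0r mulr_suml.
apply/eqP; transitivity (\sum_a B a (- b) * char a u); last first.
  by rewrite big1 // => a _; rewrite u0 mulr0.
under [RHS]eq_bigr => a _ do rewrite charE mulr_sumr.
rewrite [RHS]exchange_big big_mkcond /=; apply: eq_bigr => g _.
have -> : \sum_a B a (- b) * (iota (coef u g) * B a g.1) =
    iota (coef u g) * \sum_a B (g.1 - b) a.
  rewrite mulr_sumr; apply: eq_bigr => a _.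
  by rewrite mulrCA BD ![B _ a]BC [B a g.1 * _]mulrC.
by rewrite pairing_sum subr_eq0; case: (_ == b); rewrite ?mul1r // mul0r mulr0.
Qed.

Section Frobenius.
Hypothesis card_char : [pchar L].-nat #|F|.
Hypothesis mulq_inj : injective (fun a : A => a *+ #|F|).

Lemma char_frobenius a u : char (a *+ #|F|) u = char a u ^+ #|F|.
Proof.
rewrite !charE sum_exprn_pchar //; apply: eq_bigr => g _.
by rewrite exprMn -rmorphXn expf_card pairingMn.
Qed.

Lemma char_lift (D : {set A}) : (forall a, (a *+ #|F| \in D) = (a \in D)) ->
  exists u, forall a, char a u = (a \in D)%:R.
Proof.
(* [y] is the inverse Fourier transform of the indicator of [D]; its values lie in [F] because [D]
   is stable under multiplication by |F|. *)
move=> D_inv; pose y b := #|A|%:R^-1 * \sum_(a in D) B a (- b).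
have /fin_all_exists[c Dc] b : exists x, y b = iota x.
  apply: finField_fixed; rewrite /y exprMn sum_exprn_pchar //; congr (_ * _).
    by rewrite -(rmorph_nat iota) -fmorphV -rmorphXn expf_card.
  rewrite [RHS](reindex_inj mulq_inj) /=.
  by apply: eq_big => a; rewrite ?D_inv // => _; rewrite pairingMn.
exists (\sum_b c b *: monom F (b, 0)) => a.
rewrite rmorph_sum.
under eq_bigr => b _ do
  rewrite char_scale char_monom -Dc /y /= -mulrA mulr_suml.
rewrite -mulr_sumr exchange_big /=.
have -> : \sum_(d in D) \sum_b B d (- b) * B a b = (a \in D)%:R * #|A|%:R.
  transitivity (\sum_(d in D) ((a == d)%:R * #|A|%:R : L)).
    apply: eq_bigr => d _; rewrite -subr_eq0 -pairing_sum;
      apply: eq_bigr => b _.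
    by rewrite BD mulrC pairingN.
  rewrite -mulr_suml; congr (_ * _); case: (boolP (a \in D)) => aD.
    rewrite (bigD1 a) //= eqxx big1 ?addr0 // => d /andP[_ /negPf].
    by rewrite eq_sym => ->.
  by rewrite big1 // => d dD; case: eqP aD => [->|//]; rewrite dD.
by rewrite mulrC mulfK.
Qed.

End Frobenius.
End Characters.

(** * The cyclic factor and its nilpotent element *)

Section CyclicFactor.
Variables (F : finFieldType) (A : finZmodType) (n : nat).
Hypothesis n_gt0 : (0 < n)%N.
Local Notation R := (galg F (A * Zcyc n)%type).
Implicit Types u : R.

Definition Zcyc_gen : Zcyc n := inZp 1.

Lemma Zcyc_gen_mulrn (z : Zcyc n) : z = Zcyc_gen *+ z.
Proof.
rewrite /Zcyc_gen Zp_mulrn; apply/val_inj.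
by rewrite /= modnMml mul1n modn_small.
Qed.

Lemma Zcyc_gen_order : Zcyc_gen *+ n = 0.
Proof.
rewrite /Zcyc_gen Zp_mulrn; apply/val_inj => /=.
by rewrite modnMml mul1n -{1}(prednK n_gt0) modnn.
Qed.

Lemma pair0_mulrn j : (0 : A, Zcyc_gen) *+ j = (0, Zcyc_gen *+ j).
Proof.
elim: j => // j IHj; rewrite !mulrS IHj.
exact: (congr2 pair (addr0 0) erefl).
Qed.

Definition shift : R := monom F (0, Zcyc_gen) - 1.

Lemma monom_Zcyc (z : Zcyc n) : exists w : R, monom F (0, z) - 1 = shift * w.
Proof.
exists (\sum_(i < z) monom F (0, Zcyc_gen) ^+ i).
rewrite /shift -subrX1 -monomMn; congr (monom F _ - 1).
by rewrite pair0_mulrn -Zcyc_gen_mulrn.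
Qed.

Lemma shift_expn : [pchar F].-nat n -> shift ^+ n = 0.
Proof.
move=> n_char.
have n_charR : [pchar R].-nat n by rewrite (eq_pnat _ (pchar_lalg R)).
rewrite /shift exprDn_pchar // exprNn_pchar // expr1n -monomMn.
by rewrite pair0_mulrn Zcyc_gen_order monom0 subrr.
Qed.

Lemma star_shift : star shift = shift * - monom F (- (0, Zcyc_gen)).
Proof.
rewrite /shift starB star1 star_monom mulrN mulrBl mul1r -monomD opprB.
by rewrite subrr monom0.
Qed.

(** Modulo [shift], Y^(a,z) equals Y^(a,0), so u reduces to its sums along the fibres over [A],
    which are zero. *)
Lemma shift_dvd u : (forall b, \sum_(g | g.1 == b) coef u g = 0) ->
  exists w, u = shift * w.
Proof.
move=> u0; have /fin_all_exists[w Dw] := monom_Zcyc.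
exists (\sum_g coef u g *: (monom F (g.1, 0) * w g.2)).
have S0 : \sum_g coef u g *: monom F (g.1, 0) = 0 :> R.
  rewrite (partition_big (fun g => g.1) xpredT) //= big1 // => b _.
  under eq_bigr => g /eqP -> do [].
  by rewrite -scaler_suml u0 scale0r.
rewrite {1}(galg_sum_monom u) -[LHS]subr0 -[X in _ - X = _]S0 -sumrB
  mulr_sumr; apply: eq_bigr => -[a z] _ /=.
rewrite [RHS]mulrC -scalerAl -mulrA [w z * _]mulrC -Dw mulrBr mulr1 -monomD
  scalerBr.
by have -> : (a, 0) + (0, z) = (a, z)
  by exact: (congr2 pair (addr0 a) (add0r z)).
Qed.

Lemma card_galg_prod : #|{: R}| = (#|F| ^ (#|A| * n))%N.
Proof. by rewrite [LHS]card_ffun card_prod card_Zcyc. Qed.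

End CyclicFactor.

(** * Hull dimensions of abelian codes *)

Section AbelianCodes.
Variables (p nu k : nat) (F : finFieldType) (A : finZmodType).
Hypothesis p_prime : prime p.
Hypothesis nu_gt0 : (0 < nu)%N.
Hypothesis card_F : #|F| = (p ^ nu)%N.
Hypothesis p_card : ~~ (p %| #|A|)%N.
Let q := (p ^ nu)%N.
Let n := (p ^ k)%N.
Local Notation R := (galg F (A * Zcyc n)%type).
Let phi (a : A) := a *+ q.

Let p_char : p \in [pchar F]. Proof. exact: card_finPcharP card_F p_prime. Qed.

Lemma mulrn_coprime_inj : injective phi.
Proof.
move=> a b ab; apply/eqP; rewrite -subr_eq0; set d := a - b.
have dq : d *+ q = 0 by rewrite mulrnBl; apply/eqP; rewrite subr_eq0; apply/eqP.
have dm : d *+ #|A| = 0.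
  by rewrite -FinRing.Theory.zmodXgE -cardsT expg_cardG ?inE.
have co : coprime q #|A| by rewrite coprimeXl // prime_coprime.
have q_gt0 : (0 < q)%N by rewrite expn_gt0 prime_gt0.
have [u v Duv _] := egcdnP #|A| q_gt0.
have : d *+ (u * q) = d by rewrite Duv (eqP co) mulrnDr mulnC mulrnA dm mul0rn
  add0r.
by rewrite mulnC mulrnA dq mul0rn => /esym/eqP.
Qed.

Lemma sum_dim_hull :
  (\sum_(C in abelian_codes F (A * Zcyc n)%type) dimF (euclid_hull C) =
     \sum_(s in exponents phi n) \sum_a (n - maxn (s a) (n - s (- a)%R)))%N /\
  #|abelian_codes F (A * Zcyc n)%type| = #|exponents phi n|.
Proof.
have n_gt0 : (0 < n)%N by rewrite expn_gt0 prime_gt0.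
have A_neq0F : #|A|%:R != 0 :> F by rewrite -(dvdn_pcharf p_char).
have [L [iota [z z_prim]]] := finField_prim_root_ext A_neq0F.
have [B [BC BD B0 B_nd]] := zmod_pairing z_prim.
have A_neq0 : #|A|%:R != 0 :> L by rewrite -(rmorph_nat iota) fmorph_eq0.
have pX j : [pchar F].-nat (p ^ j)%N.
  by rewrite (eq_pnat _ (pcharf_eq p_char)) pnatX pnat_id.
have phi_inj := mulrn_coprime_inj.
have q_gt1 : (1 < q)%N by rewrite -(exp1n nu) ltn_exp2r ?prime_gt1.
pose chi := char iota (Zcyc n) BC BD B0.
have q_charL : [pchar L].-nat #|F|.
  by rewrite card_F (eq_pnat _ (fmorph_pchar iota)) pX.
have n_charR : [pchar R].-nat n by rewrite (eq_pnat _ (pchar_lalg R)) pX.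
have phiE a : phi a = a *+ #|F| by rewrite card_F.
have mulq_inj : injective (fun a : A => a *+ #|F|).
  by move=> a b /=; rewrite card_F => /phi_inj.
have chi_phi a (u : R) : chi (phi a) u = chi a u ^+ q.
  by rewrite phiE /q -card_F; apply: char_frobenius.
have chi_ker (u : R) : (forall a, chi a u = 0) -> exists v, u = shift F A n * v.
  move=> u0; apply: shift_dvd => b; apply: (char_kernel_sum B_nd A_neq0 b u0).
have pi_n : shift F A n ^+ n = 0 by apply: shift_expn => //; apply: pX.
have chi_lift (D : {set A}) : (forall a, (phi a \in D) = (a \in D)) ->
    exists u : R, forall a, chi a u = (a \in D)%:R.
  move=> D_inv; apply: char_lift => // a; by rewrite -phiE.
have card_R : #|{: R}| = (q ^ (#|A| * n))%N by rewrite card_galg_prod // card_F.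
have sums := sum_ideals phi_inj q_gt1 n_charR chi_phi chi_ker pi_n chi_lift
  card_R.
split; last first.
  have := sums (fun=> 1%N); rewrite !sum1_card => <-.
  by apply: eq_card => C; rewrite inE.
transitivity (\sum_(C : {set R} | is_ideal C) dimF (euclid_hull C))%N.
  by apply: eq_bigl => C; rewrite inE.
rewrite sums; apply: eq_bigr => s /exponentsP s_inv.
set C := pi_ideal _ _ _ _ _.
have C_ideal : is_ideal C by apply: pi_ideal_ideal.
have F_gt1 : (1 < #|F|)%N by rewrite card_F.
(* Equality of dimensions is checked as equality of cardinalities, which are powers of |F|. *)
apply/eqP; rewrite -(eqn_exp2l _ _ F_gt1) -card_submod; last first.
  by apply: euclid_hull_submod; rewrite inE.
rewrite /euclid_hull euclid_dual_ideal // {1}card_F.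
rewrite (card_pi_ideal_hull (w := - monom F (- (0, Zcyc_gen n))) phi_inj q_gt1
  n_charR chi_phi chi_ker pi_n chi_lift card_R
  (@starK F (A * Zcyc n)%type) (@starM F _) (star1 F _) (@opprK A)) //.
- by move=> a; rewrite /phi mulNrn.
- by move=> a u; apply: char_star.
- exact: star_shift.
- by move=> a; rewrite s_inv.
by move=> a; rewrite leq_ord.
Qed.
End AbelianCodes.

(** [S1] and [S2] stand for the sums over the diagonal and over all pairs, [d] for the parity of n,
    [N] for the total hull dimension and [X] for the number of codes. *)
Lemma avg_closed_form (S1 S2 N X Q m n d : nat) :
  (0 < X)%N -> (Q <= m)%N -> (4 * S1 + d = n ^ 2)%N ->
  (6 * S2 = n * n.+1 * (2 * n + 1))%N ->
  (n.+1 ^ 2 * N = X * (Q * (n.+1 * S1) + (m - Q) * S2))%N ->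
  N%:R / X%:R = m%:R * n%:R * (1 / 3 - 1 / (6 * (n%:R + 1)))
    - Q%:R * ((n%:R + 1) / 12 + (3 * d%:R - 1) / (12 * (n%:R + 1))) :> rat.
Proof.
move=> X_gt0 Q_m DS1 DS2 DN.
have X0 : X%:R != 0 :> rat by rewrite Num.Theory.pnatr_eq0 -lt0n.
have n0 : n%:R + 1 != 0 :> rat by rewrite natr1 Num.Theory.pnatr_eq0.
have E1 : S1%:R = (n%:R ^+ 2 - d%:R) / 4 :> rat.
  by rewrite -natrX -DS1 natrD natrM; field.
have E2 : S2%:R = n%:R * (n%:R + 1) * (2 * n%:R + 1) / 6 :> rat.
  have E : 6 * S2%:R = n%:R * (n%:R + 1) * (2 * n%:R + 1) :> rat.
    by rewrite -natrM DS2 !(natrM, natrD) -natr1.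
  by rewrite -E; field.
have EN : N%:R = X%:R * (Q%:R * ((n%:R + 1) * S1%:R) + (m%:R - Q%:R) * S2%:R) /
    (n%:R + 1) ^+ 2 :> rat.
  have := congr1 (fun i : nat => i%:R : rat) DN.
  rewrite !(natrM, natrD, natrX, natrB) // -natr1 => <-.
  by field.
rewrite EN E1 E2; field.
by rewrite X0 n0.
Qed.

Theorem theorem4p1 (p nu k m : nat) (hp : prime p) (hnu : (0 < nu)%N)
    (hk : p = 2%N -> (0 < k)%N)
    (F : finFieldType) (hF : #|F| = (p ^ nu)%N)
    (A : finZmodType) (hA : #|A| = m) (hpm : ~~ (p %| m)%N) :
  let n : rat := (p ^ k)%:R in
  let delta : rat := (p == 2%N)%:R in
  avg_hull_dim F (A * Zcyc (p ^ k))%type =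
    m%:R * n * (1 / 3 - 1 / (6 * (n + 1)))
    - #|Qset A (p ^ nu)|%:R
      * ((n + 1) / 12 + (2 - 3 * delta) / (12 * (n + 1))).
Proof.
move=> n delta; rewrite -hA in hpm *.
have [sumE cardE] := sum_dim_hull k hp hnu hF hpm.
have phi_inj := mulrn_coprime_inj (nu := nu) hp hpm.
pose phi (a : A) := a *+ (p ^ nu)%N.
(* The parity of p^k is 1 - [delta] except for 2^0 = 1, the case that [hk] excludes. *)
have odd_n : odd (p ^ k) = (p != 2%N).
  rewrite oddX; have [p2 | p_neq2] := eqVneq p 2%N.
    by rewrite gtn_eqF ?hk //= p2.
  by case: (even_prime hp) p_neq2 => -> //; rewrite orbT.
have -> : 2 - 3 * delta = 3 * (odd (p ^ k))%:R - 1 :> rat.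
  by rewrite odd_n /delta; case: eqP => _ /=; ring.
have QE : Qset A (p ^ nu) = [set a | fconnect phi a (- a)].
  by apply/setP => a; rewrite !inE.
rewrite /avg_hull_dim sumE cardE.
apply: (avg_closed_form _ _ (sum_min_diag (p ^ k)) (sum_min_pair (p ^ k))).
- by apply/card_gt0P; exists 0; apply/exponentsP => a; rewrite !ffunE.
- exact: max_card.
by rewrite QE; apply: sum_overlap.
Qed.
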